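(* Let $Q\geq 1$ and let $n\geq 2Q$. Then the parameters of the (directed) stochastic block model with $Q$ classes on $n$ vertices are identifiable, up to label switching, from the distribution $P_{[n]}$ of $X_{[n]}$ within the set of parameters $(\alpha,\pi)$ such that $\alpha_q>0$ for every $1\leq q\leq Q$ and the coordinates of the vector $r=\pi\alpha$ (that is, $r_q=\sum_{l=1}^Q\pi_{q,l}\alpha_l$) are pairwise distinct. That is: if $(\alpha,\pi)$ and $(\alpha',\pi')$ both belong to this set and induce the same distribution of the adjacency matrix $X_{[n]}$, then there is a permutation $\sigma$ of $\{1,\ldots,Q\}$ such that $\alpha'_q=\alpha_{\sigma(q)}$ and $\pi'_{q,l}=\pi_{\sigma(q),\sigma(l)}$ for all $q,l$.
   Context: Stochastic block model (SBM) with parameters $(\alpha,\pi)$: $\alpha=(\alpha_1,\ldots,\alpha_Q)$ is a probability vector and $\pi=(\pi_{q,l})_{1\leq q,l\leq Q}$ is a (not necessarily symmetric) matrix with entries in $[0,1]$. The labels $Z_1,\ldots,Z_n$ are i.i.d. with $\mathbb{P}(Z_i=q)=\alpha_q$. Given the labels, the entries $X_{i,j}$, $1\leq i\neq j\leq n$, of the adjacency matrix are independent, $X_{i,j}$ being Bernoulli with parameter $\pi_{Z_i,Z_j}$; moreover $X_{i,i}=0$. Only $X_{[n]}=(X_{i,j})_{1\leq i,j\leq n}$ is observed. *)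

(* Defs.v *)
From mathcomp Require Import all_boot all_order all_algebra.
From mathcomp Require Import reals bernoulli_distribution.

Set Implicit Arguments.
Unset Strict Implicit.
Unset Printing Implicit Defensive.

Import Order.TTheory GRing.Theory Num.Theory.
Local Open Scope ring_scope.

(* All the random objects live in finite types, so a distribution is given by
   its probability mass function, and two distributions are equal iff their
   mass functions agree at every point. *)
Section StochasticBlockModel.
Variables (R : realType) (Q n : nat).
Implicit Types (alpha : 'cV[R]_Q) (pi : 'M[R]_Q).
Implicit Types (z : {ffun 'I_n -> 'I_Q}) (x : 'M[bool]_n).

Definition prob_vector alpha : Prop :=
  (forall q, 0 <= alpha q 0) /\ \sum_q alpha q 0 = 1.

Definition sbm_params alpha pi : Prop :=
  prob_vector alpha /\ (forall q l, 0 <= pi q l <= 1).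

Definition label_pmf alpha z : R := \prod_(i < n) alpha (z i) 0.

(* Mass function of X_[n] given Z = z: independent entries, Bernoulli off the
   diagonal and almost surely 0 (that is, false) on the diagonal. *)
Definition entry_pmf pi z (i j : 'I_n) (b : bool) : R :=
  if i == j then (b == false)%:R else bernoulli_pmf (pi (z i) (z j)) b.

Definition adjacency_cond_pmf pi z x : R :=
  \prod_(i < n) \prod_(j < n) entry_pmf pi z i j (x i j).

Definition sbm_joint_pmf alpha pi z x : R :=
  label_pmf alpha z * adjacency_cond_pmf pi z x.

(* P_[n]: the second marginal of the law of (Z, X_[n]), the labels being
   unobserved. *)
Definition sbm_pmf alpha pi x : R :=
  \sum_(z : {ffun 'I_n -> 'I_Q}) sbm_joint_pmf alpha pi z x.

Definition sbm_identifiable_set alpha pi : Prop :=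
  [/\ sbm_params alpha pi,
      forall q, 0 < alpha q 0 &
      forall q l, q != l -> (pi *m alpha) q 0 != (pi *m alpha) l 0].

End StochasticBlockModel.

(* Main.v *)
Require Import Defs.
From mathcomp Require Import all_boot all_order all_algebra all_fingroup.
From mathcomp Require Import reals.

(** Write [r = pi alpha] for the vector of connection probabilities. The proof
    looks only at the probabilities that the observed graph contains a given
    double star: an edge from a vertex [a] to a vertex [b], together with [i]
    further edges leaving [a] and [j] further edges leaving [b], all leaves
    being distinct. Given the labels [q] of [a] and [l] of [b], the leaves are
    independent of each other, so this probability equals
      sum_(q, l) alpha_q alpha_l pi_ql r_q^i r_l^j
    ([prob_double_star]). It is a function of the observed law as soon as
    [i + j + 2 <= n] vertices are available.

    For [j = 0] the sum over [l] produces one more factor [r_q], so these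
    numbers are the moments of order [i + 1] of the measure putting mass
    [alpha_q] at the point [r_q]. With [n >= 2Q] all moments of order less than
    [2Q] are known, hence the integrals of all polynomials of degree less than
    [2Q]. Two measures with [Q] distinct atoms each which agree on these
    polynomials are equal: an atom of the second that is not an atom of the
    first would be isolated by a polynomial of degree [2Q - 1] vanishing at the
    [2Q - 1] other points ([atoms_determined]). As the coordinates of [r] are
    distinct, matching the atoms gives the permutation.

    The moments with [i, j < Q] then determine [pi]: they fix the integrals of
    [p(r_q) g(r_l)] for polynomials of degree less than [Q], and Lagrange
    polynomials at the nodes [r] isolate each number
    [alpha_q alpha_l pi_ql] ([kernel_determined]), from which [pi_ql] follows
    because the [alpha_q] are positive. The largest graph used here
    has [2 + 2 (Q - 1) = 2Q] vertices. *)

Set Implicit Arguments.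
Unset Strict Implicit.
Unset Printing Implicit Defensive.

Import Order.TTheory GRing.Theory.

Local Open Scope ring_scope.

(** * Finitely supported measures and their moments *)

Section FinitelySupportedMeasures.
Variables (F : fieldType) (I : finType).
Implicit Types (r w : I -> F) (p g : {poly F}) (M : I -> I -> F).

(** The Lagrange basis polynomial at node [r i], up to a scalar. Leaving it
    unnormalised avoids division: only its non-vanishing at [r i] matters. *)
Definition punctured_nodal_poly r (i : I) : {poly F} :=
  \prod_(j | j != i) ('X - (r j)%:P).

Lemma size_punctured_nodal_poly r i : size (punctured_nodal_poly r i) = #|I|.
Proof.
rewrite /punctured_nodal_poly -big_filter size_prod_XsubC size_filter.
by rewrite -sum1_count sum1_card cardC1 prednK //; apply/card_gt0P; exists i.
Qed.

Lemma punctured_nodal_poly_eq0 r i k :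
  k != i -> (punctured_nodal_poly r i).[r k] = 0.
Proof.
by move=> ki; rewrite horner_prod (bigD1 k) //= hornerXsubC subrr mul0r.
Qed.

Lemma punctured_nodal_poly_neq0 r i :
  injective r -> (punctured_nodal_poly r i).[r i] != 0.
Proof.
move=> r_inj; rewrite horner_prod; apply/prodf_neq0 => j ji.
by rewrite hornerXsubC subr_eq0 (inj_eq r_inj) eq_sym.
Qed.

Lemma sum_punctured_nodal_poly r w i :
  \sum_k w k * (punctured_nodal_poly r i).[r k] =
  w i * (punctured_nodal_poly r i).[r i].
Proof.
rewrite (bigD1 i) //= big1 ?addr0 // => k ki.
by rewrite punctured_nodal_poly_eq0 ?mulr0.
Qed.

Lemma eq_sum_poly_of_moments N r w r' w' :
  (forall k, (k < N)%N -> \sum_i w i * r i ^+ k = \sum_i w' i * r' i ^+ k) ->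
  forall p, (size p <= N)%N ->
  \sum_i w i * p.[r i] = \sum_i w' i * p.[r' i].
Proof.
move=> eq_mom p sz_p.
have sumE (v s : I -> F) : \sum_i v i * p.[s i] =
    \sum_(k < N) p`_k * \sum_i v i * s i ^+ k.
  under eq_bigr do rewrite (horner_coef_wide _ sz_p) mulr_sumr.
  rewrite exchange_big; apply: eq_bigr => k _; rewrite mulr_sumr.
  by apply: eq_bigr => i _; rewrite mulrCA.
by rewrite !sumE; apply: eq_bigr => k _; rewrite eq_mom.
Qed.

(** The measure [M] on pairs of nodes is handled one variable at a time: for a
    fixed exponent in one variable, [M] integrates to a measure in the other,
    to which the one-variable statement applies. *)
Lemma eq_sum_poly2_of_moments N r r' M M' :
  (forall j k, (j < N)%N -> (k < N)%N ->
    \sum_q \sum_l M q l * r q ^+ j * r l ^+ k =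
    \sum_q \sum_l M' q l * r' q ^+ j * r' l ^+ k) ->
  forall p g, (size p <= N)%N -> (size g <= N)%N ->
  \sum_q \sum_l M q l * p.[r q] * g.[r l] =
  \sum_q \sum_l M' q l * p.[r' q] * g.[r' l].
Proof.
move=> eq_mom p g sz_p sz_g.
have sumE (A : I -> I -> F) (s t : I -> F) : \sum_q \sum_l A q l * s q * t l =
    \sum_l (\sum_q A q l * s q) * t l.
  by rewrite exchange_big; apply: eq_bigr => l _; rewrite mulr_suml.
have sumE' (A : I -> I -> F) (s t : I -> F) : \sum_q \sum_l A q l * s q * t l =
    \sum_q (\sum_l A q l * t l) * s q.
  apply: eq_bigr => q _; rewrite mulr_suml.
  by apply: eq_bigr => l _; rewrite mulrAC.
rewrite !sumE; apply: eq_sum_poly_of_moments sz_g => k ltkN.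
rewrite -!sumE !sumE'; apply: eq_sum_poly_of_moments sz_p => j ltjN.
by rewrite -!sumE'; apply: eq_mom.
Qed.

(** Polynomials of degree less than [2 #|I|] separate one node of [r'] from the
    at most [2 #|I| - 1] other nodes of [r] and [r'] together, so a node of
    [r'] carrying a nonzero mass must be a node of [r]; the masses are then
    compared through Lagrange polynomials. *)
Lemma atoms_determined r w r' w' :
  injective r -> injective r' -> (forall i, w' i != 0) ->
  (forall p, (size p <= 2 * #|I|)%N ->
    \sum_i w i * p.[r i] = \sum_i w' i * p.[r' i]) ->
  exists sigma : {perm I},
    (forall i, r' i = r (sigma i)) /\ (forall i, w' i = w (sigma i)).
Proof.
move=> r_inj r'_inj w'_neq0 eq_int.
have atom_in i : exists k, r' i = r k.
  have [/existsP[k /eqP]|] := boolP [exists k, r' i == r k]; first by exists k.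
  rewrite negb_exists => /forallP/= r'i_new.
  pose p := punctured_nodal_poly r' i * \prod_k ('X - (r k)%:P).
  have sz_p : (size p <= 2 * #|I|)%N.
    apply: leq_trans (size_polyMleq _ _) _.
    rewrite size_punctured_nodal_poly size_prod_XsubC addnS /= mul2n -addnn.
    by rewrite -sum1_size sum1_card.
  have p_r k : p.[r k] = 0.
    rewrite hornerM [X in _ * X]horner_prod (bigD1 k) //=.
    by rewrite hornerXsubC subrr mul0r mulr0.
  have p_r'i : p.[r' i] != 0.
    rewrite hornerM mulf_neq0 ?punctured_nodal_poly_neq0 // horner_prod.
    by apply/prodf_neq0 => k _; rewrite hornerXsubC subr_eq0.
  have := eq_int p sz_p; rewrite big1 => [|k _]; last by rewrite p_r mulr0.
  rewrite (bigD1 i) //= big1 ?addr0 => [|k ki]; last first.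
    by rewrite hornerM punctured_nodal_poly_eq0 ?mul0r ?mulr0.
  by move/esym/eqP; rewrite mulf_eq0 (negPf (w'_neq0 i)) (negPf p_r'i).
(* Injectivity of [r'] makes this matching of nodes injective, hence a
   permutation because [I] is finite. *)
have [s r'E] := fin_all_exists atom_in.
have s_inj : injective s by move=> i j eqs; apply: r'_inj; rewrite !r'E eqs.
exists (perm s_inj); split=> i; rewrite permE //.
have sz_p : (size (punctured_nodal_poly r' i) <= 2 * #|I|)%N.
  by rewrite size_punctured_nodal_poly leq_pmull.
have := eq_int _ sz_p; rewrite sum_punctured_nodal_poly.
rewrite (reindex_inj s_inj) /=; under eq_bigr do rewrite -r'E.
rewrite (sum_punctured_nodal_poly r' (w \o s)) /= => /esym.
exact/mulIf/punctured_nodal_poly_neq0.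
Qed.

(** A product of two Lagrange polynomials picks out a single entry. *)
Lemma kernel_determined r M M' :
  injective r ->
  (forall p g, (size p <= #|I|)%N -> (size g <= #|I|)%N ->
    \sum_q \sum_l M q l * p.[r q] * g.[r l] =
    \sum_q \sum_l M' q l * p.[r q] * g.[r l]) ->
  M =2 M'.
Proof.
move=> r_inj eq_int i j.
have := eq_int (punctured_nodal_poly r i) (punctured_nodal_poly r j).
rewrite !size_punctured_nodal_poly => /(_ (leqnn _) (leqnn _)).
have sumE A : \sum_q \sum_l A q l * (punctured_nodal_poly r i).[r q] *
      (punctured_nodal_poly r j).[r l] =
    A i j * (punctured_nodal_poly r i).[r i] * (punctured_nodal_poly r j).[r j].
  under eq_bigr do rewrite sum_punctured_nodal_poly mulrAC.
  rewrite (sum_punctured_nodal_poly r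
    (fun q => A q j * (punctured_nodal_poly r j).[r j])).
  by rewrite mulrAC.
rewrite !sumE => /mulIf eqM; apply: (mulIf (punctured_nodal_poly_neq0 i r_inj)).
exact/eqM/punctured_nodal_poly_neq0.
Qed.

End FinitelySupportedMeasures.

(** * Probability of containing a given subgraph *)

Section SubgraphProbabilities.
Variables (R : realType) (Q n : nat).
Implicit Types (alpha : 'cV[R]_Q) (pi : 'M[R]_Q).
Implicit Types (z : {ffun 'I_n -> 'I_Q}) (x : 'M[bool]_n) (D : rel 'I_n).

Definition contains_edges D x : bool :=
  [forall i, forall j, D i j ==> x i j].

(** Given the labels the entries are independent, so the probability factors
    over the pairs of vertices. Irreflexivity excludes loops, which have
    probability 0. *)
Lemma cond_prob_contains_edges pi z D :
  irreflexive D ->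
  \sum_(x | contains_edges D x) adjacency_cond_pmf pi z x =
  \prod_i \prod_(j | D i j) pi (z i) (z j).
Proof.
move=> irrD.
pose G (e : 'I_n * 'I_n) b : R :=
  if D e.1 e.2 ==> b then entry_pmf pi z e.1 e.2 b else 0.
(* The event is a product of conditions on the single entries, so it can be
   absorbed in the factors before sum and product are exchanged. *)
have GE x : (if contains_edges D x then adjacency_cond_pmf pi z x else 0) =
    \prod_e G e (x e.1 e.2).
  rewrite -(pair_bigA _ (fun i j => G (i, j) (x i j))) /=.
  case: ifPn => [/forallP cDx|].
    apply: eq_bigr => i _; apply: eq_bigr => j _; rewrite /G /=.
    by have /forallP/(_ j) -> := cDx i.
  rewrite negb_forall => /existsP[i]; rewrite negb_forall => /existsP[j nDx].
  by rewrite (bigD1 i) //= (bigD1 j) //= /G /= (negPf nDx) !mul0r.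
rewrite big_mkcond /=; under eq_bigr do rewrite GE.
pose mx (f : {ffun 'I_n * 'I_n -> bool}) := \matrix_(i, j) f (i, j).
have mx_bij : bijective mx.
  exists (fun x : 'M[bool]_n => [ffun e => x e.1 e.2]) => [f|x].
    by apply/ffunP => -[i j]; rewrite ffunE mxE.
  by apply/matrixP => i j; rewrite mxE ffunE.
rewrite (reindex mx) /=; last exact: onW_bij.
under eq_bigr do under eq_bigr do rewrite mxE -surjective_pairing.
rewrite -(bigA_distr_bigA G).
rewrite -(pair_bigA _ (fun i j => \sum_b G (i, j) b)) /=.
apply: eq_bigr => i _; rewrite [RHS]big_mkcond; apply: eq_bigr => j _.
rewrite big_bool /G /entry_pmf /=; case: eqVneq => [<-|_].
  by rewrite irrD /= add0r.
by case: (D i j); rewrite /= ?addr0 // addrC subrK.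
Qed.

Lemma prob_contains_edges alpha pi D :
  irreflexive D ->
  \sum_(x | contains_edges D x) sbm_pmf alpha pi x =
  \sum_z label_pmf alpha z * \prod_i \prod_(j | D i j) pi (z i) (z j).
Proof.
move=> irrD; rewrite exchange_big; apply: eq_bigr => z _.
by rewrite -cond_prob_contains_edges // mulr_sumr.
Qed.

(** Once the labels of the two centres [a] and [b] are fixed, the labels of the
    other vertices stay independent: a leaf of [a] contributes
    [\sum_k alpha_k pi_qk = r_q], a leaf of [b] contributes [r_l], and a vertex
    outside the double star contributes [\sum_k alpha_k = 1]. *)
Lemma prob_double_star alpha pi (a b : 'I_n) (s t : seq 'I_n) :
  \sum_q alpha q 0 = 1 ->
  uniq (a :: b :: s ++ t) ->
  \sum_(x | contains_edges
      (fun i j => (i == a) && ((j == b) || (j \in s)) ||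
                  (i == b) && (j \in t)) x)
    sbm_pmf alpha pi x =
  \sum_q \sum_l (alpha q 0 * alpha l 0 * pi q l) *
    (pi *m alpha) q 0 ^+ size s * (pi *m alpha) l 0 ^+ size t.
Proof.
move=> alpha1; rewrite /= inE !mem_cat !negb_or cat_uniq.
move=> /and3P[/and3P[ab as_ at_] /andP[bs bt] /and3P[us dst ut]].
have s_notin_t i : i \in s -> i \in t = false.
  by move=> si; apply: contraNF dst => ti; apply/hasP; exists i.
have aF : (b == a) = false by rewrite eq_sym (negPf ab).
rewrite prob_contains_edges; last first.
  move=> i; case: eqVneq => [->|_] /=.
    by rewrite (negPf ab) (negPf as_).
  by case: eqVneq => [->|//] /=; rewrite (negPf bt).
(* [H q l v k] is the contribution of label [k] at vertex [v] when [a] and [b]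
   are forced to have labels [q] and [l]; the indicator factors turn the sum
   over labellings with two constrained values into a full product. *)
pose H q l v k : R := alpha k 0 * (if v == a then (k == q)%:R else 1) *
  (if v == b then (k == l)%:R else 1) * (if v \in s then pi q k else 1) *
  (if v \in t then pi l k else 1).
have HE q l (z : {ffun 'I_n -> 'I_Q}) : \prod_v H q l v (z v) =
    label_pmf alpha z * (z a == q)%:R * (z b == l)%:R *
    (\prod_(v in s) pi q (z v)) * (\prod_(v in t) pi l (z v)).
  by rewrite !big_split -!big_mkcond !big_pred1_eq.
have sumH q l v : \sum_k H q l v k =
    (if v == a then alpha q 0 else 1) * (if v == b then alpha l 0 else 1) *
    (if v \in s then (pi *m alpha) q 0 else 1) *
    (if v \in t then (pi *m alpha) l 0 else 1).
  have delta (f : 'I_Q -> R) k : \sum_i f i * (i == k)%:R = f k.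
    rewrite (bigD1 k) //= eqxx mulr1 big1 ?addr0 // => i /negPf ->.
    by rewrite mulr0.
  rewrite /H; case: (eqVneq v a) => [->|_].
    rewrite (negPf ab) (negPf as_) (negPf at_) !mulr1
      -[RHS](delta (fun k => alpha k 0)).
    by apply: eq_bigr => k _; rewrite !mulr1.
  case: (eqVneq v b) => [->|_].
    rewrite (negPf bs) (negPf bt) !mulr1 mul1r
      -[RHS](delta (fun k => alpha k 0)).
    by apply: eq_bigr => k _; rewrite !mulr1.
  case: ifPn => [/s_notin_t ->|_].
    rewrite !mul1r mulr1 mxE.
    by apply: eq_bigr => k _; rewrite !mulr1 mulrC.
  case: ifPn => _; rewrite !mul1r ?mxE.
    by apply: eq_bigr => k _; rewrite !mulr1 mulrC.
  by rewrite -[RHS]alpha1; apply: eq_bigr => k _; rewrite !mulr1.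
have star q l : (alpha q 0 * alpha l 0 * pi q l) *
    (pi *m alpha) q 0 ^+ size s * (pi *m alpha) l 0 ^+ size t =
    pi q l * \sum_(z : {ffun 'I_n -> 'I_Q}) \prod_v H q l v (z v).
  rewrite -(bigA_distr_bigA (H q l)); under eq_bigr do rewrite sumH.
  rewrite !big_split -!big_mkcond !big_pred1_eq !prodr_const.
  rewrite (card_uniqP us) (card_uniqP ut) !mulrA; congr (_ * _ * _).
  by rewrite mulrC mulrA.
under [RHS]eq_bigr do under eq_bigr do rewrite star mulr_sumr.
under [RHS]eq_bigr do rewrite exchange_big.
rewrite [RHS]exchange_big; apply: eq_bigr => z _ /=.
have edgesE : \prod_i \prod_(j | (i == a) && ((j == b) || (j \in s)) ||
      (i == b) && (j \in t)) pi (z i) (z j) =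
    pi (z a) (z b) * (\prod_(v in s) pi (z a) (z v)) *
    \prod_(v in t) pi (z b) (z v).
  rewrite (bigD1 a) //= [X in _ * X](bigD1 b) /= ?aF //.
  rewrite [X in _ * (_ * X)]big1 ?mulr1 => [|i /andP[ia ib]]; last first.
    by rewrite big_pred0 // => j; rewrite (negPf ia) (negPf ib).
  rewrite !eqxx (negPf ab) /=; congr (_ * _).
  rewrite (bigD1 b) ?eqxx //=; congr (_ * _).
  apply: eq_bigl => j; rewrite orbF; case: eqVneq => [->|_] /=.
    by rewrite (negPf bs).
  by rewrite andbT.
(* Among all (q, l), only the actual labels of [a] and [b] survive. *)
rewrite edgesE (bigD1 (z a)) //= [X in _ + X]big1 ?addr0 => [|q qa]; last first.
  rewrite big1 // => l _.
  by rewrite HE [z a == q]eq_sym (negPf qa) !(mulr0, mul0r).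
rewrite (bigD1 (z b)) //= [X in _ + X]big1 ?addr0 => [|l lb]; last first.
  by rewrite HE [z b == l]eq_sym (negPf lb) !(mulr0, mul0r).
rewrite HE !eqxx !mulr1 !mulrA; congr (_ * _ * _).
by rewrite mulrC.
Qed.

(** The double star with [i] and [j] leaves needs [i + j + 2] distinct vertices,
    which is where the bound on [n] enters. *)
Lemma double_star_moments_determined alpha pi alpha' pi' (i j : nat) :
  \sum_q alpha q 0 = 1 -> \sum_q alpha' q 0 = 1 ->
  (forall x : 'M[bool]_n, sbm_pmf alpha pi x = sbm_pmf alpha' pi' x) ->
  (i + j + 2 <= n)%N ->
  \sum_q \sum_l (alpha q 0 * alpha l 0 * pi q l) *
    (pi *m alpha) q 0 ^+ i * (pi *m alpha) l 0 ^+ j =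
  \sum_q \sum_l (alpha' q 0 * alpha' l 0 * pi' q l) *
    (pi' *m alpha') q 0 ^+ i * (pi' *m alpha') l 0 ^+ j.
Proof.
move=> alpha1 alpha'1 eq_pmf le_n.
have : (i + j + 2 <= #|'I_n|)%N by rewrite card_ord.
rewrite addn2 => /card_geqP[[|a [|b u]]] [] // uniq_abu [sz_u] _.
have sz_s : size (take i u) = i by rewrite size_takel // sz_u leq_addr.
have sz_t : size (drop i u) = j by rewrite size_drop sz_u addKn.
rewrite -(cat_take_drop i u) in uniq_abu.
have := prob_double_star pi alpha1 uniq_abu.
have := prob_double_star pi' alpha'1 uniq_abu.
rewrite sz_s sz_t => <- <-.
by apply: eq_bigr => x _; apply: eq_pmf.
Qed.

(** With no leaf at [b], the vertex [b] is itself one more leaf of [a]: the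
    double star is a star with [k + 1] leaves, so the one-variable moments
    come from the same family. *)
Lemma sum_edge_weights alpha pi k :
  \sum_q \sum_l (alpha q 0 * alpha l 0 * pi q l) *
    (pi *m alpha) q 0 ^+ k * (pi *m alpha) l 0 ^+ 0 =
  \sum_q alpha q 0 * (pi *m alpha) q 0 ^+ k.+1.
Proof.
apply: eq_bigr => q _; rewrite exprS mulrA.
rewrite [X in _ = _ * X * _]mxE mulr_sumr mulr_suml.
by apply: eq_bigr => l _; rewrite mulr1 [pi q l * _]mulrC mulrA.
Qed.

End SubgraphProbabilities.

(** * Identifiability *)

Theorem theorem2p1 (R : realType) (Q n : nat)
    (hQ : (1 <= Q)%N) (hn : (2 * Q <= n)%N)
    (alpha alpha' : 'cV[R]_Q) (pi pi' : 'M[R]_Q)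
    (hap : sbm_identifiable_set alpha pi)
    (hap' : sbm_identifiable_set alpha' pi')
    (hP : forall x : 'M[bool]_n, sbm_pmf alpha pi x = sbm_pmf alpha' pi' x) :
  exists sigma : 'S_Q,
    (forall q, alpha' q 0 = alpha (sigma q) 0) /\
    (forall q l, pi' q l = pi (sigma q) (sigma l)).
Proof.
case: hap => -[[_ alpha1] _] _ r_neq.
case: hap' => -[[_ alpha'1] _] alpha'_gt0 r'_neq.
have star_mom := double_star_moments_determined alpha1 alpha'1 hP.
pose r q := (pi *m alpha) q 0; pose r' q := (pi' *m alpha') q 0.
have r_inj : injective r.
  by move=> q l; apply: contra_eq; apply: r_neq.
have r'_inj : injective r'.
  by move=> q l; apply: contra_eq; apply: r'_neq.
have alpha'_neq0 q : alpha' q 0 != 0 by rewrite gt_eqF.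
have mom k : (k < 2 * #|'I_Q|)%N ->
    \sum_q alpha q 0 * r q ^+ k = \sum_q alpha' q 0 * r' q ^+ k.
  (* The moment of order 0 is not a double star; it is the total mass. *)
  rewrite card_ord; case: k => [_|k ltk].
    by under eq_bigr do rewrite mulr1; under [RHS]eq_bigr do rewrite mulr1;
       rewrite alpha1.
  rewrite -!sum_edge_weights; apply: star_mom.
  by rewrite addn0 addn2 (leq_trans ltk).
have [sigma [r'E alpha'E]] :=
  atoms_determined r_inj r'_inj alpha'_neq0 (eq_sum_poly_of_moments mom).
exists sigma; split=> // q l.
pose M q l := alpha q 0 * alpha l 0 * pi q l.
pose M' q l := alpha' q 0 * alpha' l 0 * pi' q l.
(* [M] transported by [sigma] lives on the nodes [r'], like [M']. *)
have : (fun q l => M (sigma q) (sigma l)) =2 M'.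
  apply: (kernel_determined r'_inj) => p g sz_p sz_g.
  have mom2 j k : (j < #|'I_Q|)%N -> (k < #|'I_Q|)%N ->
      \sum_q \sum_l M q l * r q ^+ j * r l ^+ k =
      \sum_q \sum_l M' q l * r' q ^+ j * r' l ^+ k.
    rewrite card_ord => ltj ltk; apply: star_mom.
    apply: leq_trans hn; rewrite mul2n -addnn addn2 -addSn -addnS.
    exact: leq_add.
  rewrite -(eq_sum_poly2_of_moments mom2 sz_p sz_g).
  rewrite [RHS](reindex_inj (@perm_inj _ sigma)); apply: eq_bigr => j _.
  rewrite [RHS](reindex_inj (@perm_inj _ sigma)); apply: eq_bigr => k _.
  by rewrite !r'E.
move=> /(_ q l); rewrite /M /M' -!alpha'E => /mulfI -> //.
exact: mulf_neq0.
Qed.
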